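(* Let $k\ge 1$ and let $G$ be a $k$-degenerate graph on $n$ vertices with degeneracy order $v_1,\dots,v_n$. The algorithm CONSTRUCT_CUB_REP (described in the context), run on $G$, constructs a valid $8k(\lceil 2.42\log n\rceil+1)$-dimensional cube representation of $G$; that is, its output consists of $8k(\lceil 2.42\log n\rceil+1)$ unit interval graphs on $V(G)$ (with unit interval representations) whose intersection is $G$.
   Context: Graphs are simple, finite and undirected; $\log$ is the natural logarithm; $[n]=\{1,\dots,n\}$. $G$ is $k$-degenerate if its vertices can be enumerated as $v_1,\dots,v_n$ (a degeneracy order) so that every vertex is succeeded by at most $k$ of its neighbors; fix such an order. $N_G^f(v_x)=\{v_z: z>x,\ (v_x,v_z)\in E(G)\}$. A graph is a unit interval graph if it is the intersection graph of closed intervals of one common length (rescaling gives length 1). The intersection of graphs on the same vertex set is the graph whose edge set is the intersection of their edge sets; a $d$-dimensional cube representation of $G$ is equivalent to $d$ unit interval graphs on $V(G)$ whose intersection is $G$. For a non-edge $(v_x,v_y)$ with $x<y$ put $S_{xy}=\{v_z\in N_G^f(v_x): z>y\}\cup\{v_y\}$ (weak support set) and $T_{xy}=S_{xy}\cup\{v_x\}$ (strong support set). For a (not necessarily proper, possibly partial) coloring $\mathcal C$, the set $S_{xy}$ (resp. $T_{xy}$) is favorably colored in $\mathcal C$ if all its vertices are colored and $\mathcal C(v_y)\ne\mathcal C(v_w)$ for all $v_w$ in $S_{xy}\setminus\{v_y\}$ (resp. $T_{xy}\setminus\{v_y\}$). Algorithm. Let $\alpha=\lceil 2.42\log n\rceil+1$.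 In stages $i=1,\dots,\alpha$ a coloring $\mathcal C_i$ of $V(G)$ with colors $\chi_1,\dots,\chi_{8k}$ is built. Let $BNN_i[v_y]$ (resp. $FNN_i[v_y]$) be the set of non-neighbors $v_x$ with $x<y$ (resp. $v_z$ with $z>y$) of $v_y$ such that $T_{xy}$ (resp. $T_{yz}$) is not favorably colored in any of $\mathcal C_1,\dots,\mathcal C_{i-1}$. For a (partial) coloring $\mathcal C$ let $X(v_y,\mathcal C)=\{v_x\in BNN_i[v_y]: S_{xy}\text{ favorably colored in }\mathcal C\}$, $Y(v_y,\mathcal C)=\{v_z\in FNN_i[v_y]: T_{yz}\text{ favorably colored in }\mathcal C\}$, $Z(v_y,\mathcal C)=\{v_z\in FNN_i[v_y]: S_{yz}\text{ favorably colored in }\mathcal C\}$. In stage $i$ the vertices are colored in the order $v_n,v_{n-1},\dots,v_1$; $v_y$ receives the first color $\chi_c$ ($c=1,2,\dots,8k$) such that the partial coloring $\mathcal C$ obtained from the current one by giving $v_y$ color $\chi_c$ satisfies $|X(v_y,\mathcal C)|\ge\frac34|BNN_i[v_y]|$ and $|Y(v_y,\mathcal C)|\ge\frac34|Z(v_y,\mathcal C)|$. Finally, for each $i\in[\alpha]$, $j\in[8k]$ the algorithm outputs the unit interval graph $I_{i,j}$ on $V(G)$ given by the following intervals of length $n$: $f_{i,j}(v_y)=[y+n,y+2n]$ if $\mathcal C_i(v_y)=\chi_j$, and otherwise $f_{i,j}(v_y)=[g,g+n]$ with $g=\max(\{h: (v_y,v_h)\in E(G),\ \mathcal C_i(v_h)=\chi_j\}\cup\{0\})$.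 *)

(* Defs.v *)
From mathcomp Require Import all_boot all_order all_algebra.
From mathcomp Require Import reals exp.

Set Implicit Arguments.
Unset Strict Implicit.
Unset Printing Implicit Defensive.

Import Order.TTheory GRing.Theory Num.Theory.

Definition simple_graph (V : finType) (G : rel V) : Prop :=
  symmetric G /\ irreflexive G.

Section Order.
Context (V : finType) (G : rel V).

(* An enumeration v_1, ..., v_n of V is a duplicate-free list [s] of all the
   vertices; [pos s u] is the 1-based index of u in it. *)
Context (s : seq V).

Definition pos (u : V) : nat := (index u s).+1.

Definition fwd_nbrs (u : V) : {set V} := [set w | (pos u < pos w) && G u w].

Definition degeneracy_order (k : nat) : Prop :=
  [/\ uniq s, forall u, u \in s & forall u, #|fwd_nbrs u| <= k].

(* Only used for non-edges (x, y) with pos x < pos y. *)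
Definition weak_support (x y : V) : {set V} :=
  y |: [set z in fwd_nbrs x | pos y < pos z].

Definition strong_support (x y : V) : {set V} := x |: weak_support x y.

End Order.

(* Partial colorings with colors 'I_m; the color chi_(c+1) is c : 'I_m, and
   [None] means uncolored. *)
Definition coloring (V : finType) (m : nat) := {ffun V -> option 'I_m}.

(* [A] is the weak or the strong support set of a non-edge (x, y); [y] is the
   later endpoint, whose color must not be repeated in the rest of [A]. *)
Definition favorable (V : finType) (m : nat) (C : coloring V m)
    (A : {set V}) (y : V) : bool :=
  [forall w in A, C w != None] && [forall w in A :\ y, C y != C w].

Section Algorithm.
Context (V : finType) (G : rel V) (s : seq V).

Section Stage.
Context (m : nat).

(* The colorings built in the earlier stages. *)
Context (Cs : seq (coloring V m)).

Definition unseparated (x y : V) : bool :=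
  ~~ has (fun C : coloring V m => favorable C (strong_support G s x y) y) Cs.

Definition BNN (y : V) : {set V} :=
  [set x | [&& pos s x < pos s y, ~~ G x y & unseparated x y]].

Definition FNN (y : V) : {set V} :=
  [set z | [&& pos s y < pos s z, ~~ G y z & unseparated y z]].

Definition Xset (y : V) (C : coloring V m) : {set V} :=
  [set x in BNN y | favorable C (weak_support G s x y) y].

Definition Yset (y : V) (C : coloring V m) : {set V} :=
  [set z in FNN y | favorable C (strong_support G s y z) z].

Definition Zset (y : V) (C : coloring V m) : {set V} :=
  [set z in FNN y | favorable C (weak_support G s y z) z].

(* |X| >= 3/4 |BNN| and |Y| >= 3/4 |Z|, with denominators cleared. *)
Definition acceptable (y : V) (C : coloring V m) : bool :=
  (3 * #|BNN y| <= 4 * #|Xset y C|) && (3 * #|Zset y C| <= 4 * #|Yset y C|).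

Definition assign (C : coloring V m) (y : V) (c : 'I_m) : coloring V m :=
  [ffun u => if u == y then Some c else C u].

(* [enum 'I_m] is increasing, so this picks the first acceptable color; the
   algorithm fails, with [None], when there is none. *)
Definition color_vertex (y : V) (C : coloring V m) : option (coloring V m) :=
  omap (assign C y)
    (ohead [seq c <- enum 'I_m | acceptable y (assign C y c)]).

(* [foldr] treats the last vertex of [s] first. *)
Definition stage : option (coloring V m) :=
  foldr (fun y oC => obind (color_vertex y) oC) (Some [ffun=> None]) s.

End Stage.

Fixpoint stages (m i : nat) : option (seq (coloring V m)) :=
  if i is i'.+1 then
    obind (fun Cs => omap (rcons Cs) (stage Cs)) (stages m i')
  else Some [::].

Local Open Scope ring_scope.

Context (R : realType).

(* The ceiling is nonnegative for n >= 1, so the absolute value only turns it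
   into a natural number; [ln 0 = 0], so that n = 0 gives one stage. *)
Definition num_stages (n : nat) : nat :=
  (`|Num.ceil (242 / 100 * ln (n%:R : R))| + 1)%N.

(* The maximum of the empty family of naturals is 0. *)
Definition intervals (m : nat) (C : coloring V m) (j : 'I_m) :
    {ffun V -> interval R} :=
  let n := #|V| in
  [ffun y =>
     if C y == Some j then `[(pos s y + n)%N%:R, (pos s y + 2 * n)%N%:R]
     else let g := (\max_(h | G y h && (C h == Some j)) pos s h)%N in
          `[g%:R, (g + n)%N%:R]].

Definition construct_cub_rep (k : nat) : option (seq {ffun V -> interval R}) :=
  omap (fun Cs => [seq intervals C j | C <- Cs, j <- enum 'I_(8 * k)])
    (stages (8 * k) (num_stages #|V|)).

End Algorithm.

Section CubeRepresentation.
Local Open Scope ring_scope.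
Context (R : realType) (V : finType).

Definition intersection_graph (f : V -> interval R) (u w : V) : Prop :=
  u <> w /\ exists t : R, t \in f u /\ t \in f w.

Definition common_length (f : V -> interval R) : Prop :=
  exists2 l : R, 0 < l & forall u, exists a : R, f u = `[a, a + l].

Definition cube_representation (G : rel V) (d : nat)
    (F : seq {ffun V -> interval R}) : Prop :=
  [/\ size F = d,
      forall f, f \in F -> common_length f
    & forall u w, G u w <-> (forall f, f \in F -> intersection_graph f u w)].

End CubeRepresentation.

(* Main.v *)
(** For a non-edge (x, y), at most k of the 8k candidate colors of y clash with
    the rest of the weak support S_xy, and for a non-edge (y, z) with S_yz
    favorably colored exactly one color of y (that of z) spoils T_yz.  By Markov's
    inequality fewer than 4k colors violate the condition on X and fewer than 4
    that on Y, so an acceptable color always exists.  Acceptability at y only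
    depends on the colors of y and of later vertices, so it survives to the end of
    the stage.  Counting the pairs with S_xy favorable once by their later and
    once by their earlier endpoint (sum of |X| = sum of |Z|), a stage separates at
    least 9/16 of the remaining non-edges, and at most n(n-1)(7/16)^alpha < 1
    survive alpha stages, since 2.42 ln(16/7) > 2.  Once T_xy is favorable in C_i,
    with y of color j, the left end of the interval of x in I_(i,j) is smaller than
    the position of y, so x and y are disjoint there; edges are never cut. *)

Require Import Defs.
From mathcomp Require Import all_boot all_order all_algebra.
From mathcomp Require Import reals topology normedtype derive.
From mathcomp Require Import realfun exp.
From mathcomp Require Import zify ring lra.

Set Implicit Arguments.
Unset Strict Implicit.
Unset Printing Implicit Defensive.

Import Order.TTheory GRing.Theory Num.Theory numFieldNormedType.Exports.

Local Open Scope nat_scope.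

(** Double counting: each [x] is hit by at most [b] values of [c], so the hits total at most
    [b * #|B|], while every overloaded [c] accounts for more than a quarter of [#|B|]. *)
Lemma card_overloaded (I T : finType) (r : I -> T -> bool) (B : {set T})
    (b : nat) :
  0 < b -> (forall x, x \in B -> #|[set c | r c x]| <= b) ->
  #|[set c | #|B| < 4 * #|[set x in B | r c x]|]| < 4 * b.
Proof.
move=> b_gt0 rb; set N := [set c | _].
(* The strict threshold counts as [#|B|.+1], which keeps the bound strict even for empty [B]. *)
suff: #|N| * #|B|.+1 <= 4 * b * #|B| by nia.
have: \sum_(c in N) #|B|.+1 <= \sum_(c in N) 4 * #|[set x in B | r c x]|.
  by apply: leq_sum => c; rewrite inE.
rewrite sum_nat_const => /leq_trans; apply.
rewrite -big_distrr -mulnA leq_mul2l /= mulnC -sum_nat_const.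
apply: (@leq_trans (\sum_c #|[set x in B | r c x]|)).
  by rewrite [leqRHS](bigID (mem N)) /= leq_addr.
have E (S : finType) (p : pred S) : #|[set x | p x]| = \sum_x (p x : nat).
  by rewrite -sum1dep_card big_mkcond; apply: eq_bigr => x _; case: (p x).
under eq_bigr => c _ do rewrite E.
rewrite exchange_big [leqRHS]big_mkcond /=; apply: leq_sum => x _.
have := rb x; case: (x \in B) => [/(_ isT)|_] /=; first by rewrite E.
by rewrite big1.
Qed.

(** * Support sets, acceptability, and success of every stage *)

Section Algorithm.
Context (V : finType) (G : rel V) (s : seq V).

Lemma favorable_eq (m : nat) (C D : coloring V m) (A : {set V}) (y : V) :
  y \in A -> {in A, C =1 D} -> favorable C A y = favorable D A y.
Proof.
move=> yA CD; rewrite /favorable; congr (_ && _); apply: eq_forallb_in => w.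
  by move=> wA; rewrite CD.
by rewrite !inE => /andP[_ wA]; rewrite !CD.
Qed.

Lemma mem_weak_support (x y : V) : y \in weak_support G s x y.
Proof. by rewrite !inE eqxx. Qed.

Lemma mem_strong_support (x y : V) : y \in strong_support G s x y.
Proof. by rewrite !inE eqxx orbT. Qed.

Lemma weak_support_ge (x y w : V) :
  w \in weak_support G s x y -> pos s y <= pos s w.
Proof. by rewrite !inE => /predU1P[->|/andP[_ /ltnW]]. Qed.

Lemma strong_support_ge (x y w : V) :
  pos s x < pos s y -> w \in strong_support G s x y -> pos s x <= pos s w.
Proof.
by move=> /ltnW xy /setU1P[->//|/weak_support_ge]; apply: leq_trans.
Qed.

Lemma strong_favorableE (m : nat) (C : coloring V m) (x y : V) :
  pos s x < pos s y ->
  favorable C (strong_support G s x y) y =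
    [&& C x != None, C y != C x & favorable C (weak_support G s x y) y].
Proof.
move=> xy; have nxy : x != y by apply: contraTneq xy => ->; rewrite ltnn.
rewrite /strong_support; apply/andP/and3P=> [[/forall_inP c /forall_inP d]|].
  split; first by apply: c; rewrite setU11.
    by apply: d; rewrite !inE nxy eqxx.
  apply/andP; split; apply/forall_inP => w wS.
    by apply: c; rewrite inE wS orbT.
  by apply: d; move: wS; rewrite !in_setD1 => /andP[-> wS]; rewrite inE wS orbT.
case=> cx cyx /andP[/forall_inP c /forall_inP d].
split; apply/forall_inP => w.
  by case/setU1P=> [->//|]; apply: c.
rewrite in_setD1 => /andP[wy /setU1P[->//|wS]].
by apply: d; rewrite in_setD1 wy.
Qed.

Context (s_uniq : uniq s) (s_full : forall u, u \in s).

Lemma pos_inj : injective (pos s).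
Proof. by move=> u w [] /(congr1 (nth u s)); rewrite !nth_index. Qed.

Lemma size_order : size s = #|V|.
Proof.
rewrite cardE; apply/perm_size/uniq_perm; rewrite ?enum_uniq // => u.
by rewrite s_full mem_enum.
Qed.

Lemma pos_le (u : V) : pos s u <= #|V|.
Proof. by rewrite -size_order index_mem. Qed.

Section Stage.
Context (m : nat) (Cs : seq (coloring V m)).

(** Every support set involved lies at or after [y]: [S_xy] starts at [y], [S_yz] at [z] and [T_yz]
    at [y]. *)
Lemma acceptable_eq (y : V) (C D : coloring V m) :
  (forall w, pos s y <= pos s w -> C w = D w) ->
  acceptable G s Cs y C = acceptable G s Cs y D.
Proof.
move=> CD; rewrite /acceptable; congr ((_ <= 4 * _) && (3 * _ <= 4 * _));
  apply: eq_card => x; rewrite !inE; apply: andb_id2l => /and3P[xy _ _];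
  apply: favorable_eq; rewrite ?mem_weak_support ?mem_strong_support // => w wS;
  apply: CD.
- exact: weak_support_ge wS.
- exact: leq_trans (ltnW xy) (weak_support_ge wS).
- exact: strong_support_ge wS.
Qed.

Lemma assign_other (C : coloring V m) (y w : V) (c : 'I_m) :
  w != y -> assign C y c w = C w.
Proof. by rewrite ffunE => /negPf->. Qed.

Lemma assign_id (C : coloring V m) (y : V) (c : 'I_m) :
  assign C y c y = Some c.
Proof. by rewrite ffunE eqxx. Qed.

End Stage.

Lemma acceptable_color (k : nat) (Cs : seq (coloring V (8 * k)))
    (C : coloring V (8 * k)) (y : V) :
  0 < k -> (forall u, #|fwd_nbrs G s u| <= k) ->
  (forall w, pos s y < pos s w -> C w != None) ->
  exists c, acceptable G s Cs y (assign C y c).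
Proof.
move=> k_gt0 degen C_col.
(* [r1 c x]: giving [y] color [c] spoils [S_xy]; [r2 c z]: it spoils [T_yz]. Any color outside [N1]
   and [N2] will be acceptable. *)
pose r1 (c : 'I_(8 * k)) x :=
  [exists z in weak_support G s x y, (z != y) && (C z == Some c)].
pose r2 (c : 'I_(8 * k)) z := C z == Some c.
pose B := BNN G s Cs y; pose Z := Zset G s Cs y C.
pose N1 := [set c : 'I_(8 * k) | #|B| < 4 * #|[set x in B | r1 c x]|].
pose N2 := [set c : 'I_(8 * k) | #|Z| < 4 * #|[set x in Z | r2 c x]|].
have lt_y z : pos s y < pos s z -> z != y.
  by apply: contraTneq => ->; rewrite ltnn.
have N1k : #|N1| < 4 * k.
  apply: card_overloaded => // x _.
  apply: leq_trans (degen x).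
  rewrite -(@card_imset _ _ (@Some 'I_(8 * k))); last by move=> c d [].
  apply: leq_trans (leq_imset_card C _); apply/subset_leq_card/subsetP.
  move=> _ /imsetP[c + ->]; rewrite inE => /exists_inP[z].
  rewrite !inE => /predU1P[->|/andP[zx _]]; first by rewrite eqxx.
  by move=> /andP[_ /eqP <-]; apply: imset_f; rewrite inE.
have N2k : #|N2| < 4 * 1.
  apply: card_overloaded => // z _; rewrite /r2.
  apply/card_le1_eqP => c d; rewrite !inE => /eqP-> /eqP [] //.
have /existsP[c] : [exists c, c \notin N1 :|: N2].
  rewrite -negb_forall; apply/negP => /forallP all_bad.
  have : #|'I_(8 * k)| <= #|N1 :|: N2|.
    by apply/subset_leq_card/subsetP => c _; apply: all_bad.
  (* At most [(4k - 1) + 3] colors are bad, fewer than [8k] because [k > 0]. *)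
  rewrite card_ord; have [+ _] := leq_card_setU N1 N2; lia.
have col w : pos s y <= pos s w -> assign C y c w != None.
  rewrite leq_eqVlt => /predU1P[/pos_inj<-|yw]; first by rewrite assign_id.
  by rewrite assign_other ?lt_y ?C_col.
rewrite !inE negb_or -!leqNgt => /andP[c1 c2]; exists c.
(* At most a quarter of [A] is bad, and the rest lies in [D]. *)
have split3 (A D : {set V}) (p : pred V) :
    4 * #|[set x in A | p x]| <= #|A| ->
    (forall x, x \in A -> ~~ p x -> x \in D) -> 3 * #|A| <= 4 * #|D|.
  move=> Ap AD; have: #|A :\: [set x in A | p x]| <= #|D|.
    apply/subset_leq_card/subsetP => x; rewrite !inE negb_and => /andP[+ xA].
    by rewrite xA; apply: AD.
  have := cardsID [set x in A | p x] A.
  rewrite (setIidPr _); first lia.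
  by apply/subsetP => x; rewrite inE => /andP[].
(* [S_yz] lies after [y], so [Z] does not depend on the color given to [y]. *)
have ZE : Zset G s Cs y (assign C y c) = Z.
  apply/setP => z; rewrite !inE; apply: andb_id2l => /and3P[yz _ _].
  apply: favorable_eq; first exact: mem_weak_support.
  by move=> w /weak_support_ge zw; rewrite assign_other ?lt_y ?(leq_trans yz).
rewrite /acceptable ZE; apply/andP; split.
  apply: (split3 _ _ _ c1) => x xB xr; rewrite inE xB /=.
  apply/andP; split; apply/forall_inP => w.
    by move=> /weak_support_ge; apply: col.
  rewrite in_setD1 => /andP[wy wS]; rewrite assign_id assign_other //.
  apply: contraNneq xr => cE; apply/exists_inP.
  by exists w; rewrite // wy cE /=.
apply: (split3 _ _ _ c2) => z; rewrite -{1}ZE /r2.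
rewrite !inE => /andP[zF fav] zc; rewrite zF.
have yz : pos s y < pos s z by case/and3P: zF.
by rewrite strong_favorableE // assign_id assign_other ?lt_y // zc fav.
Qed.

Lemma stage_acceptable (k : nat) (Cs : seq (coloring V (8 * k))) :
  0 < k -> (forall u, #|fwd_nbrs G s u| <= k) ->
  exists2 C, stage G s Cs = Some C & forall y, acceptable G s Cs y C.
Proof.
move=> k_gt0 degen.
(* [foldr] colors [s] from its end, so the induction runs over suffixes; when [y] is reached, [t]
   consists exactly of the later vertices ([gtE]). *)
have main t : suffix t s -> exists C,
    [/\ foldr (fun y oC => obind (color_vertex G s Cs y) oC)
          (Some [ffun=> None]) t = Some C,
        {in t, forall y, acceptable G s Cs y C} &
        {in t, forall u, C u != None}].
  elim: t => [_|y t IH yt]; first by exists [ffun=> None].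
  have [|C [E acc col]] := IH.
    by apply: suffix_trans yt; apply: (suffix_suffix [:: y]).
  case/suffixP: yt => p sE.
  have: uniq (p ++ y :: t) by rewrite -sE.
  rewrite cat_uniq /= negb_or => /and3P[_ /andP[yp /hasPn tp] /andP[yNt _]].
  have gtE w : (pos s y < pos s w) = (w \in t).
    have := s_full w; rewrite sE mem_cat inE /pos ltnS !index_cat (negPf yp).
    case: (boolP (w \in p)) => [wp _|_] /=.
      rewrite (_ : (w \in t) = false); last first.
        by apply/negP => /tp; rewrite /= wp.
      move: wp; rewrite -index_mem eqxx addn0 => /ltnW.
      by rewrite leqNgt => /negPf.
    rewrite eqxx eq_sym; case: eqVneq => /= [<-|_ ->]; last lia.
    by rewrite (negPf yNt); lia.
  have [c0 c0P] : exists c, acceptable G s Cs y (assign C y c).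
    by apply: acceptable_color => // w; rewrite gtE; apply: col.
  rewrite /= E /= /color_vertex; set l := [seq _ <- _ | _].
  have c0l : c0 \in l by rewrite mem_filter c0P mem_enum.
  case lE : l c0l => [//|c l'] _ /=; exists (assign C y c).
  have : c \in l by rewrite lE mem_head.
  rewrite mem_filter => /andP[cP _].
  split=> // u; rewrite inE => /predU1P[->|ut].
  - by [].
  (* [y] precedes [u], so coloring it leaves acceptability at [u] intact. *)
  - rewrite -(@acceptable_eq _ Cs u C) ?acc // => w uw.
    rewrite assign_other //; apply: contraTneq ut => wy.
    by rewrite -gtE -wy -leqNgt.
  - by rewrite assign_id.
  - by rewrite ffunE; case: ifP => // _; apply: col.
have [C [stE acc _]] := main s (suffix_refl s).
by exists C => // y; apply: acc.
Qed.

(** * Geometric decay of the number of unseparated non-edges *)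

Lemma unseparated_rcons (m : nat) (Cs : seq (coloring V m)) C x y :
  unseparated G s (rcons Cs C) x y =
    unseparated G s Cs x y && ~~ favorable C (strong_support G s x y) y.
Proof. by rewrite /unseparated has_rcons negb_or andbC. Qed.

Lemma sum_BNN_rcons (m : nat) (Cs : seq (coloring V m)) (C : coloring V m) :
  (forall y, acceptable G s Cs y C) ->
  16 * (\sum_y #|BNN G s (rcons Cs C) y|) <= 7 * \sum_y #|BNN G s Cs y|.
Proof.
move=> acc.
have swap (A D : V -> {set V}) : (forall x y, (x \in A y) = (y \in D x)) ->
    \sum_y #|A y| = \sum_x #|D x|.
  have cardE (B : {set V}) : #|B| = \sum_x (x \in B : nat).
    by rewrite -sum1_card big_mkcond; apply: eq_bigr => x _; case: (x \in B).
  move=> AD; under eq_bigr => y _ do rewrite cardE.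
  under [RHS]eq_bigr => x _ do rewrite cardE.
  rewrite exchange_big; apply: eq_bigr => x _.
  by apply: eq_bigr => y _; rewrite AD.
(* [W] indexes the newly separated pairs by their later endpoint, [Yset] the same pairs by their
   earlier one. *)
pose W y := [set x in BNN G s Cs y | favorable C (strong_support G s x y) y].
have XZ : \sum_y #|Xset G s Cs y C| = \sum_x #|Zset G s Cs x C|.
  by apply: swap => x y; rewrite !inE.
have WY : \sum_y #|W y| = \sum_x #|Yset G s Cs x C|.
  by apply: swap => x y; rewrite !inE.
have X34 : 3 * (\sum_y #|BNN G s Cs y|) <= 4 * \sum_y #|Xset G s Cs y C|.
  by rewrite !big_distrr; apply: leq_sum => y _; case/andP: (acc y).
have Y34 : 3 * (\sum_y #|Zset G s Cs y C|) <= 4 * \sum_y #|Yset G s Cs y C|.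
  by rewrite !big_distrr; apply: leq_sum => y _; case/andP: (acc y).
have: \sum_y #|BNN G s Cs y| = \sum_y #|W y| + \sum_y #|BNN G s (rcons Cs C) y|.
  rewrite -big_split; apply: eq_bigr => y _ /=.
  rewrite -(cardsID (W y) (BNN G s Cs y)).
  congr (_ + _); apply: eq_card => x; rewrite !inE ?unseparated_rcons.
    by case: (_ < _); case: (G x y); case: unseparated.
  by case: (_ < _); case: (G x y); case: unseparated; rewrite ?andbF ?andbT.
(* In sums: [W = Y >= 3/4 Z = 3/4 X >= 9/16 BNN], which leaves at most 7/16. *)
lia.
Qed.

Lemma stages_separate (k i : nat) :
  0 < k -> (forall u, #|fwd_nbrs G s u| <= k) ->
  exists2 Cs, stages G s (8 * k) i = Some Cs &
    size Cs = i /\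
    16 ^ i * (\sum_y #|BNN G s Cs y|) <= 7 ^ i * (#|V| * #|V|.-1).
Proof.
move=> k_gt0 degen; elim: i => [|i [Cs Cs_def [Cs_size IH]]].
  exists [::] => //; split=> //; rewrite !mul1n -sum_nat_const.
  (* [BNN y] omits [y] itself; having [n(n-1)] instead of [n^2] makes the final estimate strict. *)
  apply: leq_sum => y _; rewrite -(cardsC1 y).
  apply/subset_leq_card/subsetP => x.
  by rewrite !inE => /and3P[+ _ _]; apply: contraTneq => ->; rewrite ltnn.
have [C stC acc] := stage_acceptable Cs k_gt0 degen.
exists (rcons Cs C); first by rewrite /= Cs_def /= stC.
split; first by rewrite size_rcons Cs_size.
have := sum_BNN_rcons acc; rewrite !expnS; nia.
Qed.

End Algorithm.

(** * Logarithm estimates behind the constant 2.42 *)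

Local Open Scope ring_scope.

(** Mean value theorem: [f x = ln x + 4 / (x + 1)] has derivative [(x - 1)^2 / (x (x + 1)^2) >= 0]
    and [f 1 = 2]. *)
Lemma ln_ge_pade (R : realType) (t : R) :
  1 <= t -> 2 * (t - 1) / (t + 1) <= ln t.
Proof.
move=> t1; pose f x : R := ln x + 4 * (x + 1)^-1.
pose df x : R := x^-1 - 4 * (x + 1)^-2.
have f_der (x : R) : 1 <= x -> is_derive (x : R^o) 1 f (df x).
  move=> x1; rewrite /f /df.
  have xD1 : x + 1 != 0 by lra.
  have x0 : 0 < x by lra.
  have ln_der := is_derive1_ln x0.
  have inv_der : is_derive (x : R^o) 1 (fun y : R^o => (y + 1)^-1)
      (- (x + 1) ^- 2 *: (1 + 0)).
    exact: is_deriveV.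
  apply: is_derive_eq.
  by rewrite addr0 scaler1; congr (_ + _); rewrite /GRing.scale /=; ring.
have [x xt E] : exists2 x : R, x \in `[1, t] & f t - f 1 = df x * (t - 1).
  apply: MVT_segment => // [|].
    by move=> y; rewrite in_itv => /andP[/ltW/f_der].
  apply: derivable_within_continuous => y; rewrite in_itv => /andP[/f_der H _].
  by case: H.
have x1 : 1 <= x by move: xt; rewrite in_itv => /andP[].
have df_ge0 : 0 <= df x.
  rewrite /df (_ : _ - _ = (x - 1) ^+ 2 / (x * (x + 1) ^+ 2)); last first.
    by field; apply/andP; split; lra.
  by rewrite divr_ge0 ?sqr_ge0 // mulr_ge0 ?sqr_ge0; lra.
have : 0 <= f t - f 1 by rewrite E mulr_ge0 // subr_ge0.
rewrite /f ln1 (_ : 2 * (t - 1) / (t + 1) = 2 - 4 * (t + 1)^-1); last first.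
  by field; lra.
have -> : 4 / (1 + 1) = 2 :> R by field.
lra.
Qed.

(** The logarithm telescopes over the factors [(i + 1) / i], at which the Pade bound equals
    [2 / (2i + 1)]. *)
Lemma ln_ge_sum (R : realType) (a d : nat) : (0 < a)%N ->
  \sum_(a <= i < a + d) 2 / i.*2.+1%:R <= ln ((a + d)%:R / a%:R : R).
Proof.
move=> a0; elim: d => [|d IH].
  by rewrite addn0 big_geq // divff ?ln1 // pnatr_eq0 -lt0n.
rewrite addnS big_nat_recr ?leq_addr //=.
have a0' : 0 < a%:R :> R by rewrite ltr0n.
have ad0 : 0 < (a + d)%:R :> R by rewrite ltr0n addn_gt0 a0.
rewrite (_ : (a + d).+1%:R / a%:R =
    ((a + d)%:R / a%:R) * ((a + d).+1%:R / (a + d)%:R)); last first.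
  by field; rewrite -natrD !lt0r_neq0.
rewrite lnM ?posrE ?divr_gt0 ?ltr0n ?addn_gt0 ?a0 //; apply: lerD => //.
apply: le_trans _ (ln_ge_pade _); last by rewrite ler_pdivlMr // mul1r ler_nat.
rewrite -[(a + d).+1]addn1 -addn1 -mul2n !natrD ?natrM ?natrD.
rewrite natrD in ad0.
rewrite le_eqVlt; apply/orP; left; apply/eqP; field.
by apply/andP; split; lra.
Qed.

(* The bound is tight (2.0006), so 16/7 = 32/14 is split into the 18 factors
   (i + 1) / i for 14 <= i < 32 before estimating each logarithm. *)
Lemma ln_16_7 (R : realType) : 2 <= 242 / 100 * ln (16 / 7 : R).
Proof.
have := @ln_ge_sum R 14 18 isT.
have -> : (14 + 18)%:R / 14%:R = 16 / 7 :> R by lra.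
move=> /(le_trans _) h; rewrite -ler_pdivrMl //; last lra.
apply: h; rewrite (_ : 14 + 18 = 32)%N //.
rewrite /index_iota /= !big_cons big_nil /double /=.
lra.
Qed.

Lemma num_stages_ge (R : realType) (n : nat) :
  242 / 100 * ln (n%:R : R) <= (num_stages R n)%:R.
Proof.
rewrite natrD natr_absz; apply: (le_trans (Num.Theory.ceil_ge _)).
apply: (@le_trans _ _ `|Num.ceil (242 / 100 * ln (n%:R : R))|%:~R).
  by rewrite ler_int ler_norm.
by rewrite lerDl.
Qed.

(** With [a] stages, [2 ln n <= 2.42 ln(16/7) ln n <= a ln(16/7)]. *)
Lemma num_stages_enough (R : realType) (n : nat) :
  (0 < n -> 7 ^ num_stages R n * n ^ 2 <= 16 ^ num_stages R n)%N.
Proof.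
move=> n_gt0; set a := num_stages R n.
have n_ge1 : 1 <= n%:R :> R by rewrite ler1n.
have lnn_ge0 : 0 <= ln (n%:R : R) by apply: ln_ge0.
have a_ge : 242 / 100 * ln (n%:R : R) <= a%:R by apply: num_stages_ge.
have key : n%:R ^+ 2 <= (16 / 7) ^+ a :> R.
  rewrite -ler_ln ?posrE ?exprn_gt0 ?lnXn ?ltr0n //; try lra.
  rewrite -[_ *+ 2]mulr_natl -[_ *+ a]mulr_natl.
  have := ln_16_7 R; nra.
rewrite -(ler_nat R) natrM !natrX mulrC -ler_pdivlMr ?exprn_gt0 ?ltr0n //.
by rewrite -expr_div_n.
Qed.

(** * Edges and separated non-edges in one interval graph *)

Section Geometry.
Context (V : finType) (G : rel V) (s : seq V) (R : realType).
Context (s_uniq : uniq s) (s_full : forall u, u \in s).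
Context (m : nat) (C : coloring V m) (j : 'I_m).

Lemma intervals_common_length : common_length (intervals G s R C j).
Proof.
(* The common length [n] must be positive; without vertices any length serves. *)
case: (posnP #|V|) => [V0|V_gt0].
  by exists 1 => // u; have := fintype0 u V0.
exists #|V|%:R => [|u]; first by rewrite ltr0n.
rewrite ffunE; case: ifP => _ /=; last by eexists; rewrite natrD.
by exists (pos s u + #|V|)%:R; rewrite -natrD mul2n -addnn addnA.
Qed.

(** A common integer point: the larger position plus [n] if both have color [j], the position of the
    [j]-colored endpoint plus [n] if only one has, and [n] if neither has. *)
Lemma intervals_edge (u w : V) : symmetric G -> irreflexive G -> G u w ->
  intersection_graph (intervals G s R C j) u w.
Proof.
move=> G_sym G_irr uw; split=> [uE|]; first by rewrite uE G_irr in uw.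
pose g y := (\max_(h | G y h && (C h == Some j)) pos s h)%N.
have g_le y : (g y <= #|V|)%N by apply/bigmax_leqP => h _; apply: pos_le.
have g_ge y h : G y h -> C h == Some j -> (pos s h <= g y)%N.
  by move=> yh hj; apply: (@leq_bigmax_cond _ _ (pos s) h); rewrite yh.
have pu := pos_le s_uniq s_full u; have pw := pos_le s_uniq s_full w.
suff [t tu tw] : exists2 t : nat, t%:R \in intervals G s R C j u &
    t%:R \in intervals G s R C j w by exists t%:R.
rewrite !ffunE -/(g u) -/(g w).
case: ifP => uj; case: ifP => wj.
- exists (maxn (pos s u) (pos s w) + #|V|)%N; rewrite in_itv /= !ler_nat;
    move: (pos s u) (pos s w) #|V| pu pw {g_le g_ge} => a b n; lia.
- have := g_ge w u; rewrite G_sym => /(_ uw uj) gu; have := g_le w => gw.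
  exists (pos s u + #|V|)%N; rewrite in_itv /= !ler_nat;
    move: (pos s u) (g w) #|V| pu gu gw => a b n; lia.
- have := g_ge u w uw wj => gw; have := g_le u => gu.
  exists (pos s w + #|V|)%N; rewrite in_itv /= !ler_nat;
    move: (pos s w) (g u) #|V| pw gu gw => a b n; lia.
- have := g_le u => gu; have := g_le w => gw.
  by exists #|V|; rewrite in_itv /= !ler_nat ?gu ?gw leq_addl.
Qed.

(** A [j]-colored neighbor of [x] is not [y], and after [y] it would lie in [S_xy] and repeat the
    color of [y]; so it precedes [y]. *)
Lemma intervals_nonedge (x y : V) :
  (pos s x < pos s y)%N -> ~~ G x y -> C y = Some j ->
  favorable C (strong_support G s x y) y ->
  ~ intersection_graph (intervals G s R C j) x y.
Proof.
move=> xy nG yj; rewrite strong_favorableE // yj => /and3P[_ jx /andP[_ fav]].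
case=> _ [t [+ +]]; rewrite !ffunE yj eqxx eq_sym (negPf jx) !in_itv /=.
move=> /andP[_ tx] /andP[ty _]; have := le_trans ty tx; rewrite ler_nat.
rewrite leq_add2r leqNgt => /negP; apply.
(* Positions start at 1, so the strict bound also covers an empty maximum. *)
rewrite (@leq_ltn_trans (pos s y).-1) // ?prednK //.
apply/bigmax_leqP => h /andP[xh /eqP hj]; rewrite -ltnS prednK //.
rewrite ltn_neqAle; apply/andP; split.
  by apply: contraNneq nG => /(pos_inj s_full) <-.
rewrite leqNgt; apply/negP => yh; move/forall_inP/(_ h): fav.
rewrite yj hj eqxx /=; case/(_ _)/negP => //.
rewrite !inE xh yh (ltn_trans xy yh) orbT andbT.
by apply: contraTneq yh => ->; rewrite ltnn.
Qed.

End Geometry.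

(** * Assembling the representation from the separated pairs *)

Theorem theorem2 (R : realType) (V : finType) (G : rel V) (k : nat)
    (s : seq V) (hG : simple_graph G) (hk : (1 <= k)%N)
    (hs : degeneracy_order G s k) :
  exists2 F : seq {ffun V -> interval R},
    construct_cub_rep G s R k = Some F &
    cube_representation G
      (8 * k * (`|Num.ceil (242 / 100 * ln (#|V|%:R : R))| + 1))%N F.
Proof.
have [G_sym G_irr] := hG; have [s_uniq s_full degen] := hs.
set a := num_stages R #|V|.
have [Cs CsE [Cs_size BNN_le]] := stages_separate s_uniq s_full a hk degen.
have BNN0 : (\sum_y #|BNN G s Cs y| = 0)%N.
  case: (posnP #|V|) => [V0|V_gt0].
    by apply: big1 => y; have := fintype0 y V0.
  (* [16^a sum <= 7^a n(n-1) < 7^a n^2 <= 16^a] forces the sum to be 0. *)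
  have := num_stages_enough R V_gt0; rewrite -/a.
  have : (0 < 7 ^ a)%N by rewrite expn_gt0.
  by nia.
rewrite /construct_cub_rep -/a CsE /=; eexists; first by reflexivity.
have mem_intervals C j : C \in Cs ->
    intervals G s R C j \in
      [seq intervals G s R C j | C <- Cs, j <- enum 'I_(8 * k)].
  by move=> CCs; apply: allpairs_f; rewrite // mem_enum.
split=> [|f /allpairsP[[C j] [_ _ ->]]|u w].
- by rewrite size_allpairs Cs_size size_enum_ord mulnC.
- exact: intervals_common_length.
split=> [uw f /allpairsP[[C j] [_ _ ->]]|all_int].
  exact: intervals_edge.
have nonedge x y : (pos s x < pos s y)%N -> ~~ G x y ->
    exists2 f,
      f \in [seq intervals G s R C j | C <- Cs, j <- enum 'I_(8 * k)] &
      ~ intersection_graph f x y.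
  move=> xy nG; have : x \notin BNN G s Cs y.
    move/eqP: BNN0; rewrite sum_nat_eq0 => /forallP/(_ y).
    by rewrite cards_eq0 => /eqP ->; rewrite inE.
  rewrite inE xy nG /= negbK => /hasP[C CCs fav].
  (* Favorability includes that [y] is colored; its color selects the separating graph. *)
  have /andP[/forall_inP/(_ y (mem_strong_support _ _ _ _))] := fav.
  case yj : (C y) => [j|//] _ _; exists (intervals G s R C j).
    exact: mem_intervals.
  exact: intervals_nonedge fav.
apply: contraT => nG.
case: (ltngtP (pos s u) (pos s w)) => [uw|wu|/(pos_inj s_full) uwE].
- by have [f fF] := nonedge _ _ uw nG; case; apply: all_int.
- rewrite G_sym in nG; have [f fF []] := nonedge _ _ wu nG.
  by have [nuw [t [tu tw]]] := all_int f fF; split; [exact/nesym|exists t].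
(* For [u = w], any one output graph gives a contradiction, being loopless; one exists since there
   is at least one stage and [8k > 0]. *)
- case: Cs Cs_size mem_intervals {CsE BNN_le BNN0 nonedge} all_int
    => [|C Cs] Cs_size mem all_int.
    by move: Cs_size; rewrite /a /num_stages addn1.
  have k8 : (0 < 8 * k)%N by rewrite muln_gt0.
  by have [] := all_int _ (mem C (Ordinal k8) (mem_head _ _)).
Qed.
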